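(* Let $d=p^2+4q$. For all integers $m,n\ge 1$, \begin{align*} V_{n}^{2}-dU_{n}^{2}&=(-q)^{n-1}\left(V_{1}^{2}-dU_{1}^{2}\right)=4(-q)^{n}\left(V_{0}+\left(-1+q-q^{2}+q^{3}\right)\right),\\ v_{m}V_{n}+du_{m}U_{n}&=2V_{m+n},\\ u_{m}V_{n}+v_{m}U_{n}&=2U_{m+n},\\ V_{m}V_{n}+dU_{m}U_{n}&=V_{1}V_{m+n-1}+dU_{1}U_{m+n-1},\\ U_{m}V_{n}+V_{m}U_{n}&=U_{1}V_{m+n-1}+V_{1}U_{m+n-1}. \end{align*}
   Context: Let $H$ be the real quaternion algebra with basis $1,i,j,k$ and (non-commutative) multiplication determined by $i^2=j^2=k^2=-1$, $ij=-ji=k$, $jk=-kj=i$, $ki=-ik=j$; real scalars commute with all quaternions. Fix real numbers $p,q$. For real $a,b$, the Horadam sequence $w_n(a,b;p,q)$ is defined by $w_0=a$, $w_1=b$, $w_n=pw_{n-1}+qw_{n-2}$ for $n\ge 2$. Let $u_n=w_n(0,1;p,q)$ (the $(p,q)$-Fibonacci numbers) and $v_n=w_n(2,p;p,q)$ (the $(p,q)$-Lucas numbers). The $(p,q)$-Fibonacci quaternions are $U_n=u_n+u_{n+1}i+u_{n+2}j+u_{n+3}k$ and the $(p,q)$-Lucas quaternions are $V_n=v_n+v_{n+1}i+v_{n+2}j+v_{n+3}k$. Here $X^2=XX$. *)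

(* Defs.v *)
From HB Require Import structures.
From mathcomp Require Import all_boot all_order all_algebra.
From mathcomp Require Import ring.
From mathcomp Require Export reals.

Set Implicit Arguments.
Unset Strict Implicit.
Unset Printing Implicit Defensive.

Import GRing.Theory.
Local Open Scope ring_scope.

(* Quat a b c d stands for a + b i + c j + d k. *)
Record quat (R : Type) : Type := Quat { qre : R; qim_i : R; qim_j : R; qim_k : R }.

Definition quat_tuple (R : Type) (x : quat R) : R * R * R * R :=
  (qre x, qim_i x, qim_j x, qim_k x).
Definition tuple_quat (R : Type) (t : R * R * R * R) : quat R :=
  Quat t.1.1.1 t.1.1.2 t.1.2 t.2.

Lemma quat_tupleK (R : Type) : cancel (@quat_tuple R) (@tuple_quat R).
Proof. by case. Qed.

HB.instance Definition _ (R : choiceType) :=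
  Choice.copy (quat R) (can_type (@quat_tupleK R)).

Section QuaternionAlgebra.
Variable R : comNzRingType.
Implicit Types (x y z : quat R) (a b : R).

Definition qzero : quat R := Quat 0 0 0 0.
Definition qone : quat R := Quat 1 0 0 0.
Definition qopp x : quat R := Quat (- qre x) (- qim_i x) (- qim_j x) (- qim_k x).
Definition qadd x y : quat R :=
  Quat (qre x + qre y) (qim_i x + qim_i y) (qim_j x + qim_j y) (qim_k x + qim_k y).
Definition qscale a x : quat R :=
  Quat (a * qre x) (a * qim_i x) (a * qim_j x) (a * qim_k x).

(* Hamilton product: the bilinear extension of i^2 = j^2 = k^2 = -1,
   ij = -ji = k, jk = -kj = i, ki = -ik = j. *)
Definition qmul x y : quat R :=
  let: Quat x0 x1 x2 x3 := x in
  let: Quat y0 y1 y2 y3 := y in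
  Quat (x0 * y0 - x1 * y1 - x2 * y2 - x3 * y3)
       (x0 * y1 + x1 * y0 + x2 * y3 - x3 * y2)
       (x0 * y2 - x1 * y3 + x2 * y0 + x3 * y1)
       (x0 * y3 + x1 * y2 - x2 * y1 + x3 * y0).

Lemma qaddA : associative qadd.
Proof. by move=> [????] [????] [????]; congr Quat; rewrite /= addrA. Qed.
Lemma qaddC : commutative qadd.
Proof. by move=> [????] [????]; congr Quat; rewrite /= addrC. Qed.
Lemma qadd0 : left_id qzero qadd.
Proof. by move=> [????]; congr Quat; rewrite /= add0r. Qed.
Lemma qaddN : left_inverse qzero qopp qadd.
Proof. by move=> [????]; congr Quat; rewrite /= addNr. Qed.

HB.instance Definition _ :=
  GRing.isZmodule.Build (quat R) qaddA qaddC qadd0 qaddN.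

Lemma qmulA : associative qmul.
Proof. by move=> [????] [????] [????]; congr Quat => /=; ring. Qed.
Lemma qmul1 : left_id qone qmul.
Proof. by move=> [????]; congr Quat => /=; ring. Qed.
Lemma qmulr1 : right_id qone qmul.
Proof. by move=> [????]; congr Quat => /=; ring. Qed.
Lemma qmulDl : left_distributive qmul +%R.
Proof. by move=> [????] [????] [????]; congr Quat => /=; ring. Qed.
Lemma qmulDr : right_distributive qmul +%R.
Proof. by move=> [????] [????] [????]; congr Quat => /=; ring. Qed.
Lemma qone_neq0 : qone != 0.
Proof. by apply/eqP => -[] /eqP; rewrite oner_eq0. Qed.

HB.instance Definition _ := GRing.Zmodule_isNzRing.Build (quat R)
  qmulA qmul1 qmulr1 qmulDl qmulDr qone_neq0.

Lemma qscaleA a b x : qscale a (qscale b x) = qscale (a * b) x.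
Proof. by congr Quat; rewrite /= mulrA. Qed.
Lemma qscale1 : left_id 1 qscale.
Proof. by move=> [????]; congr Quat; rewrite /= mul1r. Qed.
Lemma qscaleDr : right_distributive qscale +%R.
Proof. by move=> a x y; congr Quat; rewrite /= mulrDr. Qed.
Lemma qscaleDl x : {morph qscale^~ x : a b / a + b}.
Proof. by move=> a b; congr Quat; rewrite /= mulrDl. Qed.

HB.instance Definition _ := GRing.Zmodule_isLmodule.Build R (quat R)
  qscaleA qscale1 qscaleDr qscaleDl.

Lemma qscaleAl a x y : a *: (x * y) = (a *: x) * y.
Proof. by case: x y => [????] [????]; congr Quat => /=; ring. Qed.

HB.instance Definition _ := GRing.Lmodule_isLalgebra.Build R (quat R) qscaleAl.

Lemma qscaleAr a x y : a *: (x * y) = x * (a *: y).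
Proof. by case: x y => [????] [????]; congr Quat => /=; ring. Qed.

HB.instance Definition _ := GRing.Lalgebra_isAlgebra.Build R (quat R) qscaleAr.

Definition qi : quat R := Quat 0 1 0 0.
Definition qj : quat R := Quat 0 0 1 0.
Definition qk : quat R := Quat 0 0 0 1.

Lemma quat_basis (a b c d : R) :
  Quat a b c d = a%:A + b *: qi + c *: qj + d *: qk.
Proof. by congr Quat => /=; ring. Qed.

Lemma quat_relations :
  [/\ [/\ qi * qi = -1, qj * qj = -1 & qk * qk = -1],
      qi * qj = qk /\ qj * qi = - qk,
      qj * qk = qi /\ qk * qj = - qi
    & qk * qi = qj /\ qi * qk = - qj].
Proof. by do ![split]; congr Quat => /=; ring. Qed.

End QuaternionAlgebra.

Arguments qi {R}.
Arguments qj {R}.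
Arguments qk {R}.

Section Horadam.
Variable R : comNzRingType.

Fixpoint horadam (a b p q : R) (n : nat) : R :=
  match n with
  | 0 => a
  | n'.+1 => match n' with
             | 0 => b
             | n''.+1 => p * horadam a b p q n' + q * horadam a b p q n''
             end
  end.

Definition fib_pq (p q : R) : nat -> R := horadam 0 1 p q.
Definition luc_pq (p q : R) : nat -> R := horadam 2 p p q.

Definition seq_quat (w : nat -> R) (n : nat) : quat R :=
  (w n)%:A + w n.+1 *: qi + w n.+2 *: qj + w n.+3 *: qk.

Definition fib_quat (p q : R) : nat -> quat R := seq_quat (fib_pq p q).
Definition luc_quat (p q : R) : nat -> quat R := seq_quat (luc_pq p q).

End Horadam.

(* Main.v *)
(* A Horadam sequence is determined by two consecutive terms, and the Lucas
   numbers are v_n = 2 u_(n+1) - p u_n.  Hence each step below, from index n to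
   n+1 or from the pair (m+1, n) to (m, n+1), is a polynomial identity in p, q
   and two consecutive terms of each Fibonacci sequence involved; the theorem
   follows by iterating these steps. *)

Require Import Defs.
From mathcomp Require Import all_boot all_order all_algebra.
From mathcomp Require Import reals ring.

Set Implicit Arguments.
Unset Strict Implicit.
Unset Printing Implicit Defensive.

Import GRing.Theory.
Local Open Scope ring_scope.

Section FibonacciLucasQuaternions.
Variables (R : comNzRingType) (p q : R).
Local Notation d := (p ^+ 2 + 4 * q).
Local Notation u := (fib_pq p q).
Local Notation v := (luc_pq p q).
Local Notation U := (fib_quat p q).
Local Notation V := (luc_quat p q).

Lemma fib_pqSS n : u n.+2 = p * u n.+1 + q * u n.
Proof. by []. Qed.

Lemma luc_pqSS n : v n.+2 = p * v n.+1 + q * v n.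
Proof. by []. Qed.

(** Eliminates [v], so that later identities involve only [u], where [ring] can decide them. *)
Lemma luc_pqE n : v n = 2 * u n.+1 - p * u n.
Proof.
(* The recurrence has order two, so the induction carries two consecutive indices. *)
suff [] : v n = 2 * u n.+1 - p * u n /\ v n.+1 = 2 * u n.+2 - p * u n.+1 by [].
elim: n => [|n [IHn IHn1]]; first by rewrite /luc_pq /fib_pq /=; split; ring.
by split=> //; rewrite luc_pqSS IHn IHn1 (fib_pqSS n.+1) (fib_pqSS n); ring.
Qed.

Lemma luc_pqD m n : v m * v n + d * u m * u n = 2 * v (m + n).
Proof.
elim: m n => [|m IHm] n; first by rewrite /luc_pq /fib_pq /=; ring.
(* One unit moves from [m] to [n]: the induction hypothesis is used at [n.+1]. *)
by rewrite addSnnS -IHm !luc_pqE !fib_pqSS; ring.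
Qed.

Lemma fib_pqD m n : u m * v n + v m * u n = 2 * u (m + n).
Proof.
elim: m n => [|m IHm] n; first by rewrite /luc_pq /fib_pq /=; ring.
by rewrite addSnnS -IHm !luc_pqE !fib_pqSS; ring.
Qed.

Lemma seq_quatE (w : nat -> R) n :
  seq_quat w n = Quat (w n) (w n.+1) (w n.+2) (w n.+3).
Proof. by rewrite quat_basis. Qed.

Lemma luc_quatD m n : v m *: V n + (d * u m) *: U n = 2 *: V (m + n).
Proof.
(* Each coordinate is the scalar identity with [n] raised by 0, 1, 2 or 3. *)
by rewrite /fib_quat /luc_quat !seq_quatE -!addnS; congr Quat; apply: luc_pqD.
Qed.

Lemma fib_quatD m n : u m *: V n + v m *: U n = 2 *: U (m + n).
Proof.
by rewrite /fib_quat /luc_quat !seq_quatE -!addnS; congr Quat; apply: fib_pqD.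
Qed.

(** In Binet form, with α, β the roots of x² = px + q, V_n = Aα^n + Bβ^n and (α-β)U_n = Aα^n - Bβ^n
    for fixed quaternions A, B. The cross terms AB and BA cancel, leaving 2(A²α^(m+n) + B²β^(m+n)),
    which depends on m+n only. *)
Lemma luc_fib_quat_mul_shift m n :
  V m.+1 * V n + d *: (U m.+1 * U n) = V m * V n.+1 + d *: (U m * U n.+1).
Proof.
rewrite /fib_quat /luc_quat !seq_quatE !luc_pqE !fib_pqSS.
by congr Quat => /=; ring.
Qed.

Lemma fib_luc_quat_mul_shift m n :
  U m.+1 * V n + V m.+1 * U n = U m * V n.+1 + V m * U n.+1.
Proof.
rewrite /fib_quat /luc_quat !seq_quatE !luc_pqE !fib_pqSS.
by congr Quat => /=; ring.
Qed.

Lemma luc_fib_quat_mul m n :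
  V m.+1 * V n + d *: (U m.+1 * U n)
    = V 1%N * V (m + n) + d *: (U 1%N * U (m + n)).
Proof.
by elim: m n => [|m IHm] n //; rewrite luc_fib_quat_mul_shift IHm addnS.
Qed.

Lemma fib_luc_quat_mul m n :
  U m.+1 * V n + V m.+1 * U n = U 1%N * V (m + n) + V 1%N * U (m + n).
Proof.
by elim: m n => [|m IHm] n //; rewrite fib_luc_quat_mul_shift IHm addnS.
Qed.

(** Here only the cross terms 2(AB + BA)(αβ)^n survive, and αβ = -q. *)
Lemma luc_fib_quat_sqrS n :
  V n.+1 ^+ 2 - d *: U n.+1 ^+ 2 = (- q) *: (V n ^+ 2 - d *: U n ^+ 2).
Proof.
rewrite !expr2 /fib_quat /luc_quat !seq_quatE !luc_pqE !fib_pqSS.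
by congr Quat => /=; ring.
Qed.

Lemma luc_fib_quat_sqr0 :
  V 0%N ^+ 2 - d *: U 0%N ^+ 2
    = 4 *: (V 0%N + (- 1 + q - q ^+ 2 + q ^+ 3)%:A).
Proof.
rewrite !expr2 /fib_quat /luc_quat !seq_quatE /luc_pq /fib_pq /=.
by congr Quat => /=; ring.
Qed.

(** The base index [n] stays free because both 1 and 0 are needed. *)
Lemma luc_fib_quat_sqr k n :
  V (k + n) ^+ 2 - d *: U (k + n) ^+ 2
    = (- q) ^+ k *: (V n ^+ 2 - d *: U n ^+ 2).
Proof.
elim: k => [|k IHk]; first by rewrite scale1r.
by rewrite addSn luc_fib_quat_sqrS IHk scalerA -exprS.
Qed.

End FibonacciLucasQuaternions.

Theorem theorem2p5 (R : realType) (p q : R) (m n : nat)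
    (hm : (1 <= m)%N) (hn : (1 <= n)%N) :
  let d : R := p ^+ 2 + 4 * q in
  let u := fib_pq p q in
  let v := luc_pq p q in
  let U := fib_quat p q in
  let V := luc_quat p q in
  (V n ^+ 2 - d *: U n ^+ 2
     = (- q) ^+ (n - 1) *: (V 1%N ^+ 2 - d *: U 1%N ^+ 2)) /\
  ((- q) ^+ (n - 1) *: (V 1%N ^+ 2 - d *: U 1%N ^+ 2)
     = (4 * (- q) ^+ n) *: (V 0%N + (- 1 + q - q ^+ 2 + q ^+ 3)%:A)) /\
  (v m *: V n + (d * u m) *: U n = 2 *: V (m + n)%N) /\
  (u m *: V n + v m *: U n = 2 *: U (m + n)%N) /\
  (V m * V n + d *: (U m * U n)
     = V 1%N * V (m + n - 1)%N + d *: (U 1%N * U (m + n - 1)%N)) /\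
  (U m * V n + V m * U n
     = U 1%N * V (m + n - 1)%N + V 1%N * U (m + n - 1)%N).
Proof.
case: m n hm hn => [//|m] [//|n] _ _ d u v U V.
rewrite !subn1 addSn /=; split; first by rewrite -luc_fib_quat_sqr addn1.
(* Climbs from index 1 back to [n.+1], then descends to index 0. *)
split; first by rewrite -luc_fib_quat_sqr addn1 -[n.+1 in LHS]addn0
  luc_fib_quat_sqr luc_fib_quat_sqr0 scalerA mulrC.
split; first exact: luc_quatD.
split; first exact: fib_quatD.
by split; [apply: luc_fib_quat_mul | apply: fib_luc_quat_mul].
Qed.
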